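(* Let $(R,\mathfrak m)$ be either a Noetherian local ring with maximal ideal $\mathfrak m$, or a standard graded $K$-algebra over a field $K$ with graded maximal ideal $\mathfrak m$. Let $I\subsetneq R$ be a proper ideal, assumed to be graded in the graded case. Then: (a) If $\operatorname{depth} R/I^k$ is a non-increasing function of $k\ge 1$, then $\mathfrak m$ is a persistent prime ideal of $I$. (b) If $I$ has non-increasing depth functions, then $I$ satisfies the persistence property. (c) $\max_{P\in\operatorname{Ass}^{\infty}(I)}\{\operatorname{dstab}(IR_P)\}\leq\operatorname{astab}(I)$. If in addition $I$ has non-increasing depth functions, then $\operatorname{astab}(I)\leq \max_{P\in V(I)}\{\operatorname{dstab}(IR_P)\}$.
   Context: $\operatorname{Ass}(J)$ denotes the set of associated prime ideals of $R/J$. $V(I)$ is the set of all prime ideals of $R$ containing $I$. By theorems of Brodmann, $\operatorname{Ass}(I^k)$ and $\operatorname{depth} R/I^k$ are constant for $k\gg 0$. $\operatorname{Ass}^\infty(I)$ is the stable value of $\operatorname{Ass}(I^k)$ for $k\gg0$. $\operatorname{astab}(I)$ is the smallest integer $k_1\ge 1$ such that $\operatorname{Ass}(I^k)=\operatorname{Ass}(I^{k_1})$ for all $k\ge k_1$. For an ideal $J$ of a local ring (or a graded ideal $J$ of a standard graded algebra) $A$, $\operatorname{dstab}(J)$ is the smallest integer $k_0\ge1$ such that $\operatorname{depth} A/J^k=\operatorname{depth} A/J^{k_0}$ for all $k\ge k_0$. In the graded case, depth is taken with respect to the graded maximal ideal. A prime $P\in V(I)$ is a persistent prime ideal of $I$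 if, whenever $P\in\operatorname{Ass}(I^k)$ for some $k$, then $P\in \operatorname{Ass}(I^{k+1})$. The ideal $I$ has the persistence property if every $P\in\bigcup_{k\ge1}\operatorname{Ass}(I^k)$ is a persistent prime ideal of $I$. In the local case, $I$ has non-increasing depth functions if for all $P\in V(I)$ the function $k\mapsto\operatorname{depth} R_P/I^kR_P$ is non-increasing. In the graded case this is required only for the graded primes $P\in V(I)$. The maximum over the possibly infinite set $V(I)$ is read as a supremum in $\mathbb N\cup\{\infty\}$. *)

(* Defs.v *)
From HB Require Import structures.
From mathcomp Require Import all_boot all_algebra.
From mathcomp Require Import boolp classical_sets.
From mathcomp Require Import ring.

Set Implicit Arguments.
Unset Strict Implicit.
Unset Printing Implicit Defensive.

Import GRing.Theory.
Local Open Scope classical_set_scope.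
Local Open Scope quotient_scope.
Local Open Scope ring_scope.

(* Extended natural numbers, with None standing for infinity. *)
Definition enat := option nat.

Definition enat_le (x y : enat) : bool :=
  match x, y with
  | _, None => true
  | None, Some _ => false
  | Some m, Some n => (m <= n)%N
  end.

(* The minimum of a set of natural numbers, infinite if the set is empty. *)
Definition enat_min (A : set nat) : enat :=
  match pselect (exists n, `[< A n >]) with
  | left exA => Some (ex_minn exA)
  | right _ => None
  end.

Definition enat_sup (A : set enat) : enat :=
  enat_min [set n | forall x, A x -> enat_le x (Some n)].

Lemma enat_minP (A : set nat) n :
  enat_min A = Some n <-> A n /\ forall k, A k -> (n <= k)%N.
Proof.
rewrite /enat_min; case: pselect => [exA|nexA].
  case: ex_minnP => m /asboolP Am mmin; split=> [[<-]|[An nmin]].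
    by split=> // k Ak; apply/mmin/asboolP.
  congr Some; apply/eqP; rewrite eqn_leq nmin //.
  by rewrite mmin //; apply/asboolP.
by split=> // -[An _]; case: nexA; exists n; apply/asboolP.
Qed.

Lemma enat_sup_ub (A : set enat) x : A x -> enat_le x (enat_sup A).
Proof.
case E: (enat_sup A) => [n|] Ax; last by case: x Ax.
by move/enat_minP: E => [+ _]; apply.
Qed.

Lemma enat_sup_least (A : set enat) y :
  (forall x, A x -> enat_le x y) -> enat_le (enat_sup A) y.
Proof.
case: y => [n|] ub; last by case: enat_sup.
rewrite /enat_sup /enat_min; case: pselect => [exA|]; last first.
  by case; exists n; apply/asboolP.
by case: ex_minnP => m _; apply; apply/asboolP.
Qed.

Section Modules.
Variables (R : comNzRingType) (V : lmodType R).

(* The submodule generated by S. *)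
Definition span (S : set V) : {pred V} :=
  fun x => `[< forall W : submodClosed V,
                 (forall y, S y -> y \in W) -> x \in W >].

Lemma spanP (S : set V) x :
  reflect (forall W : submodClosed V, (forall y, S y -> y \in W) -> x \in W)
          (x \in span S).
Proof. exact: asboolP. Qed.

Fact span_submod_closed (S : set V) : submod_closed (span S).
Proof.
split=> [|a u v /spanP Su /spanP Sv]; apply/spanP => W SW; first exact: rpred0.
by rewrite rpredD ?rpredZ ?Su ?Sv.
Qed.
HB.instance Definition _ (S : set V) :=
  GRing.isSubmodClosed.Build R V (span S) (span_submod_closed S).

End Modules.

Section QuotientModule.
Variables (R : comNzRingType) (V : lmodType R) (W : submodClosed V).

(* The library only equips submodClosed predicates with zmodClosed when their
   head symbol is known. *)
Definition submod_pred : {pred V} := W.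
HB.instance Definition _ :=
  GRing.isZmodClosed.Build V submod_pred (GRing.submod_closedB (submodClosedP W)).

Definition quotmod := Quotient.quot submod_pred.

HB.instance Definition _ := GRing.Zmodule.on quotmod.

Definition quotmod_proj (x : V) : quotmod := \pi_(Quotient.quot submod_pred) x.

Lemma quotmod_projE (x y : V) :
  (quotmod_proj x == quotmod_proj y) = (x - y \in W).
Proof. exact: esym (Quotient.idealrBE submod_pred x y). Qed.

Lemma quotmod_projP (z : quotmod) : exists x, z = quotmod_proj x.
Proof. by exists (repr z); rewrite /quotmod_proj reprK. Qed.

Fact quotmod_proj_is_zmod_morphism : zmod_morphism quotmod_proj.
Proof. by move=> x y; rewrite /quotmod_proj raddfB. Qed.
HB.instance Definition _ :=
  GRing.isZmodMorphism.Build V quotmod quotmod_proj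
    quotmod_proj_is_zmod_morphism.

Definition quotmod_scale (a : R) (z : quotmod) : quotmod :=
  quotmod_proj (a *: repr (z : Quotient.quot submod_pred)).

Fact quotmod_proj_scale a x :
  quotmod_scale a (quotmod_proj x) = quotmod_proj (a *: x).
Proof.
apply/eqP; rewrite quotmod_projE -scalerBr rpredZ //.
by rewrite (Quotient.idealrBE submod_pred) reprK.
Qed.

Fact quotmod_scaleA a b z :
  quotmod_scale a (quotmod_scale b z) = quotmod_scale (a * b) z.
Proof.
by case: (quotmod_projP z) => x ->; rewrite !quotmod_proj_scale scalerA.
Qed.

Fact quotmod_scale1 : left_id 1 quotmod_scale.
Proof.
move=> z; case: (quotmod_projP z) => x ->.
by rewrite quotmod_proj_scale scale1r.
Qed.

Fact quotmod_scaleDr : right_distributive quotmod_scale +%R.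
Proof.
move=> a z t; case: (quotmod_projP z) => x ->; case: (quotmod_projP t) => y ->.
by rewrite -raddfD !quotmod_proj_scale -raddfD scalerDr.
Qed.

Fact quotmod_scaleDl z : {morph quotmod_scale^~ z : a b / a + b}.
Proof.
move=> a b; case: (quotmod_projP z) => x ->.
by rewrite !quotmod_proj_scale -raddfD scalerDl.
Qed.

HB.instance Definition _ :=
  GRing.Zmodule_isLmodule.Build R quotmod
    quotmod_scaleA quotmod_scale1 quotmod_scaleDr quotmod_scaleDl.

End QuotientModule.

Section Localization.
Variables (R : comNzRingType) (P : prime_idealr R).

Definition denom := {s : R | s \notin P}.

Fact one_notin : 1 \notin P. Proof. by rewrite idealr1. Qed.
Fact mul_notin (s t : denom) : sval s * sval t \notin P.
Proof. by rewrite prime_idealrM negb_or (svalP s) (svalP t). Qed.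

Definition denom1 : denom := exist _ 1 one_notin.
Definition denomM (s t : denom) : denom := exist _ (sval s * sval t) (mul_notin s t).

Definition frac := (R * denom)%type.

Definition frac_eqv (x y : frac) : bool :=
  `[< exists u : denom, sval u * (x.1 * sval y.2 - y.1 * sval x.2) = 0 >].

Fact frac_eqv_refl : reflexive frac_eqv.
Proof. by move=> x; apply/asboolP; exists denom1; rewrite subrr mulr0. Qed.

Fact frac_eqv_sym : symmetric frac_eqv.
Proof.
move=> x y; apply/asboolP/asboolP => -[u e]; exists u;
by rewrite -opprB mulrN e oppr0.
Qed.

Fact frac_eqv_trans : transitive frac_eqv.
Proof.
move=> y x z /asboolP[u xy] /asboolP[v yz]; apply/asboolP.
exists (denomM (denomM u v) y.2) => /=.
transitivity (sval v * sval z.2 * (sval u * (x.1 * sval y.2 - y.1 * sval x.2))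
  + sval u * sval x.2 * (sval v * (y.1 * sval z.2 - z.1 * sval y.2))); first by ring.
by rewrite xy yz !mulr0 addr0.
Qed.

Canonical frac_eqv_equiv :=
  EquivRel frac_eqv frac_eqv_refl frac_eqv_sym frac_eqv_trans.
Canonical frac_eqv_encModRel := defaultEncModRel frac_eqv.

(* The localization R_P. *)
Definition loc := {eq_quot frac_eqv}.
HB.instance Definition _ : EqQuotient _ frac_eqv loc := EqQuotient.on loc.
HB.instance Definition _ := Choice.on loc.

Definition mkloc (a : R) (s : denom) : loc := \pi_loc (a, s).

Lemma mklocP a s b t :
  mkloc a s = mkloc b t <->
  exists u : denom, sval u * (a * sval t - b * sval s) = 0.
Proof.
rewrite /mkloc; split.
  by move/eqmodP => /asboolP.
by move=> h; apply/eqmodP/asboolP.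
Qed.

Lemma loc_ind (x : loc) : exists a s, x = mkloc a s.
Proof.
exists (repr x).1, (repr x).2.
by rewrite /mkloc -surjective_pairing reprK.
Qed.

Definition loc_add (x y : loc) : loc :=
  mkloc ((repr x).1 * sval (repr y).2 + (repr y).1 * sval (repr x).2)
        (denomM (repr x).2 (repr y).2).
Definition loc_opp (x : loc) : loc := mkloc (- (repr x).1) (repr x).2.
Definition loc_mul (x y : loc) : loc :=
  mkloc ((repr x).1 * (repr y).1) (denomM (repr x).2 (repr y).2).

Lemma repr_mkloc a s : exists u : denom,
  sval u * ((repr (mkloc a s)).1 * sval s - a * sval (repr (mkloc a s)).2) = 0.
Proof.
apply/mklocP; rewrite /mkloc -surjective_pairing.
exact: reprK.
Qed.

Lemma loc_addE a s b t :
  loc_add (mkloc a s) (mkloc b t) = mkloc (a * sval t + b * sval s) (denomM s t).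
Proof.
rewrite /loc_add; move: (repr_mkloc a s) (repr_mkloc b t).
move: (repr (mkloc a s)) (repr (mkloc b t)) => [a' s'] [b' t'] /= [u ea] [v eb].
apply/mklocP; exists (denomM u v) => /=.
transitivity (sval v * sval t' * sval t * (sval u * (a' * sval s - a * sval s'))
  + sval u * sval s * sval s' * (sval v * (b' * sval t - b * sval t'))); first by ring.
by rewrite ea eb !mulr0 addr0.
Qed.

Lemma loc_oppE a s : loc_opp (mkloc a s) = mkloc (- a) s.
Proof.
rewrite /loc_opp; move: (repr_mkloc a s).
move: (repr (mkloc a s)) => [a' s'] /= [u ea].
apply/mklocP; exists u.
by rewrite !mulNr -opprD mulrN ea oppr0.
Qed.

Lemma loc_mulE a s b t :
  loc_mul (mkloc a s) (mkloc b t) = mkloc (a * b) (denomM s t).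
Proof.
rewrite /loc_mul; move: (repr_mkloc a s) (repr_mkloc b t).
move: (repr (mkloc a s)) (repr (mkloc b t)) => [a' s'] [b' t'] /= [u ea] [v eb].
apply/mklocP; exists (denomM u v) => /=.
transitivity (sval v * b' * sval t * (sval u * (a' * sval s - a * sval s'))
  + sval u * a * sval s' * (sval v * (b' * sval t - b * sval t'))); first by ring.
by rewrite ea eb !mulr0 addr0.
Qed.

Lemma mkloc_eq a s b t : a * sval t = b * sval s -> mkloc a s = mkloc b t.
Proof. by move=> e; apply/mklocP; exists denom1; rewrite e subrr mulr0. Qed.

Fact loc_addA : associative loc_add.
Proof.
move=> x y z; case: (loc_ind x) (loc_ind y) (loc_ind z).
move=> a [s ->] [b [t ->]] [c [r ->]].
by rewrite !loc_addE; apply: mkloc_eq => /=; ring.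
Qed.

Fact loc_addC : commutative loc_add.
Proof.
move=> x y; case: (loc_ind x) (loc_ind y) => a [s ->] [b [t ->]].
by rewrite !loc_addE; apply: mkloc_eq => /=; ring.
Qed.

Fact loc_add0 : left_id (mkloc 0 denom1) loc_add.
Proof.
move=> x; case: (loc_ind x) => a [s ->].
by rewrite !loc_addE; apply: mkloc_eq => /=; ring.
Qed.

Fact loc_addN : left_inverse (mkloc 0 denom1) loc_opp loc_add.
Proof.
move=> x; case: (loc_ind x) => a [s ->].
by rewrite loc_oppE !loc_addE; apply: mkloc_eq => /=; ring.
Qed.

HB.instance Definition _ :=
  GRing.isZmodule.Build loc loc_addA loc_addC loc_add0 loc_addN.

Fact loc_mulA : associative loc_mul.
Proof.
move=> x y z; case: (loc_ind x) (loc_ind y) (loc_ind z).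
move=> a [s ->] [b [t ->]] [c [r ->]].
by rewrite !loc_mulE; apply: mkloc_eq => /=; ring.
Qed.

Fact loc_mulC : commutative loc_mul.
Proof.
move=> x y; case: (loc_ind x) (loc_ind y) => a [s ->] [b [t ->]].
by rewrite !loc_mulE; apply: mkloc_eq => /=; ring.
Qed.

Fact loc_mul1 : left_id (mkloc 1 denom1) loc_mul.
Proof.
move=> x; case: (loc_ind x) => a [s ->].
by rewrite !loc_mulE; apply: mkloc_eq => /=; ring.
Qed.

Fact loc_mulDl : left_distributive loc_mul loc_add.
Proof.
move=> x y z; case: (loc_ind x) (loc_ind y) (loc_ind z).
move=> a [s ->] [b [t ->]] [c [r ->]].
by rewrite !(loc_mulE, loc_addE); apply: mkloc_eq => /=; ring.
Qed.

Fact loc_oner_neq0 : mkloc 1 denom1 != 0 :> loc.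
Proof.
apply/eqP => /mklocP[u] /= ; rewrite mul0r subr0 !mulr1 => u0.
by have := svalP u; rewrite u0 idealr0.
Qed.

HB.instance Definition _ :=
  GRing.Zmodule_isComNzRing.Build loc
    loc_mulA loc_mulC loc_mul1 loc_mulDl loc_oner_neq0.

(* The extension J R_P of J. *)
Definition loc_ext (J : {pred R}) : submodClosed loc^o :=
  @span loc loc^o [set mkloc a denom1 | a in [set` J]].

End Localization.

Arguments loc {R} P.
Arguments mkloc {R P} a s.
Arguments loc_ext {R} P J.

Section AssociatedPrimesDepth.
Variable R : comNzRingType.

(* The ideal J^k, generated by the products of k elements of J. *)
Definition ipow (J : {pred R}) (k : nat) : submodClosed R^o :=
  span [set x : R^o | exists2 s : k.-tuple R,
          {subset s <= J} & x = \prod_(a <- s) a].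

(* Sets of primes are plain predicates: prime_idealr R is too large a type for
   the universe of classical_sets. *)
Definition Ass (M : lmodType R) (P : prime_idealr R) : Prop :=
  exists x : M, forall a : R, a \in P <-> a *: x = 0.

(* The submodule (s)M. *)
Definition seqmul (M : lmodType R) (s : seq R) : submodClosed M :=
  span [set y : M | exists2 a : R, a \in s & exists z : M, y = a *: z].

(* s_i is a nonzerodivisor on M/(s_0, ..., s_(i-1))M, and M/(s)M <> 0. *)
Definition regular_seq (M : lmodType R) (s : seq R) : Prop :=
  (forall i, (i < size s)%N ->
     forall y : quotmod (seqmul M (take i s)), s`_i *: y = 0 -> y = 0)
  /\ (exists y : quotmod (seqmul M s), y != 0).

(* Depth of M with respect to the ideal n.  It is only used for M <> 0, the
   depth of the zero module being 0 here. *)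
Definition depth (n : {pred R}) (M : lmodType R) : enat :=
  enat_sup [set Some (size s) | s in
    [set s : seq R | {subset s <= n} /\ regular_seq M s]].

Definition dstab (n J : {pred R}) : enat :=
  enat_min [set k0 | (1 <= k0)%N /\ forall k, (k0 <= k)%N ->
    depth n (quotmod (ipow J k)) = depth n (quotmod (ipow J k0))].

Definition nonincreasing_ge1 (f : nat -> enat) : Prop :=
  forall k l, (1 <= k <= l)%N -> enat_le (f l) (f k).

End AssociatedPrimesDepth.

Section Asymptotics.
Variables (R : comNzRingType) (I : {pred R}).

Definition Vprimes (P : prime_idealr R) : Prop := {subset I <= P}.

Definition Ass_pow (k : nat) (P : prime_idealr R) : Prop :=
  Ass (quotmod (ipow I k)) P.

Definition Ass_pow_stable (k1 : nat) : Prop :=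
  (1 <= k1)%N /\
  forall k, (k1 <= k)%N -> forall P, Ass_pow k P <-> Ass_pow k1 P.

Definition astab : enat := enat_min [set k1 | Ass_pow_stable k1].

Definition Ass_infty (P : prime_idealr R) : Prop :=
  exists2 k1, Ass_pow_stable k1 & Ass_pow k1 P.

(* The maximal ideal P R_P of R_P. *)
Definition loc_max (P : prime_idealr R) : {pred loc P} := loc_ext P P.

Definition depth_function (P : prime_idealr R) (k : nat) : enat :=
  depth (@loc_max P) (quotmod (loc_ext P (ipow I k))).

Definition dstab_loc (P : prime_idealr R) : enat :=
  dstab (@loc_max P) (loc_ext P I).

Definition sup_dstab_loc (S : prime_idealr R -> Prop) : enat :=
  enat_sup [set d | exists2 P, S P & d = dstab_loc P].

(* I has non-increasing depth functions at all primes of S containing I. *)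
Definition nonincreasing_depth_functions (S : prime_idealr R -> Prop) : Prop :=
  forall P, Vprimes P -> S P -> nonincreasing_ge1 (depth_function P).

Definition persistent (P : prime_idealr R) : Prop :=
  Vprimes P /\ forall k, (1 <= k)%N -> Ass_pow k P -> Ass_pow k.+1 P.

Definition persistence_property : Prop :=
  forall P k, (1 <= k)%N -> Ass_pow k P -> persistent P.

End Asymptotics.

Definition noetherian (R : comNzRingType) : Prop :=
  forall J : submodClosed R^o, exists s : seq R^o, J =i span [set` s].

Definition maximal_ideal (R : comNzRingType) (m : idealr R) : Prop :=
  forall J : idealr R, {subset m <= J} -> J =i m.

Definition local_ring (R : comNzRingType) (m : idealr R) : Prop :=
  maximal_ideal m /\ forall n : idealr R, maximal_ideal n -> n =i m.

Section Graded.
Variables (K : fieldType) (R : comAlgType K) (gr : nat -> submodClosed R).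

(* R is the direct sum of the gr i, gr 0 = K, and R is generated as a K-algebra
   by finitely many elements of degree 1. *)
Definition standard_graded : Prop :=
  [/\ (forall x : R, exists c : nat -> R, exists2 n : nat,
         (forall i, c i \in gr i) & x = \sum_(i < n) c i),
      (forall (c : nat -> R) (n : nat), (forall i, c i \in gr i) ->
         \sum_(i < n) c i = 0 -> forall i, (i < n)%N -> c i = 0),
      (forall i j x y, x \in gr i -> y \in gr j -> x * y \in gr (i + j)%N),
      (forall x, x \in gr 0%N <-> exists a : K, x = a%:A)
    & (exists2 s : seq R, {subset s <= gr 1%N} &
         forall A : subalgClosed R, {subset s <= A} -> forall x, x \in A)].

Definition homogeneous (x : R) : Prop := exists i, x \in gr i.

(* Generated by homogeneous elements. *)
Definition graded_ideal (J : {pred R}) : Prop :=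
  forall x : R^o, x \in J <-> x \in span [set h : R^o | h \in J /\ homogeneous h].

(* The graded maximal ideal. *)
Definition irrelevant : submodClosed R^o :=
  span [set x : R^o | exists2 i, (0 < i)%N & x \in gr i].

End Graded.

(* Main.v *)
From HB Require Import structures.
From mathcomp Require Import all_boot all_algebra.
From mathcomp Require Import boolp classical_sets.
From mathcomp Require Import ring.
Require Import Defs.

(* For a prime [P] containing [I], the depth of [R_P / I^k R_P] is 0 if and only
   if every element of [P R_P] is a zero divisor on it, and, [R] being
   noetherian, if and only if [P] is an associated prime of [I^k].  Hence
   [Ass (I^k)] is read off from the zeros of the depth functions: a non-increasing
   depth function stays at 0 once it gets there, and the stabilization indices
   [dstab (I R_P)] and [astab I] bound each other as claimed.  In the graded case
   [R] is noetherian by Hilbert's basis theorem, and only graded primes matter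
   because the associated primes of a graded ideal are graded. *)

Set Implicit Arguments.
Unset Strict Implicit.
Unset Printing Implicit Defensive.

Import GRing.Theory.
Local Open Scope classical_set_scope.
Local Open Scope ring_scope.

(** * Zero divisors modulo an ideal of a noetherian ring *)

Section Span.
Variables (R : comNzRingType) (V : lmodType R).

Lemma span_incl (S : set V) x : S x -> x \in span S.
Proof. by move=> Sx; apply/spanP => W; apply. Qed.

Definition submod_of (p : {pred V}) (h : GRing.submod_closed p) :
  submodClosed V := HB.pack p (GRing.isSubmodClosed.Build R V p h).

Lemma span_ind (S : set V) (Q : V -> Prop) :
  Q 0 -> (forall a u v, Q u -> Q v -> Q (a *: u + v)) ->
  (forall y, S y -> Q y) -> forall x, x \in span S -> Q x.
Proof.
move=> Q0 QZD QS x /spanP Sx.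
have h : GRing.submod_closed ([pred y | `[< Q y >]] : {pred V}).
  split=> [|a u v]; first exact/asboolP.
  by move=> /asboolP Qu /asboolP Qv; apply/asboolP/QZD.
by have /asboolP := Sx (submod_of h) (fun y Sy => asboolT (QS y Sy)).
Qed.

Lemma span_sub (S : set V) (W : submodClosed V) :
  (forall y, S y -> y \in W) -> {subset span S <= W}.
Proof. by move=> SW x /spanP; apply. Qed.

End Span.

Section Noetherian.
Variable R : comNzRingType.
Implicit Types p q : {pred R}.

(** Unlike [idealr], this admits the unit ideal, so that all colon ideals qualify. *)
Definition ideal_closed p := GRing.submod_closed (p : {pred R^o}).

Section IdealTheory.
Variables (p : {pred R}) (idp : ideal_closed p).

Lemma ideal_closed0 : 0 \in p. Proof. by case: idp. Qed.
Lemma ideal_closedZD a x y : x \in p -> y \in p -> a * x + y \in p.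
Proof. by case: idp => _; apply. Qed.
Lemma ideal_closedM a x : x \in p -> a * x \in p.
Proof.
by move=> px; rewrite -[a * x]addr0; apply: ideal_closedZD ideal_closed0.
Qed.
Lemma ideal_closedD x y : x \in p -> y \in p -> x + y \in p.
Proof. by move=> px py; rewrite -[x]mul1r; apply: ideal_closedZD. Qed.
Lemma ideal_closedB x y : x \in p -> y \in p -> x - y \in p.
Proof. by move=> px py; rewrite addrC -mulN1r; apply: ideal_closedZD. Qed.
Lemma ideal_closed_expM a x m n : (m <= n)%N ->
  a ^+ m * x \in p -> a ^+ n * x \in p.
Proof.
by move=> mn pax; rewrite -(subnK mn) exprD -mulrA; apply: ideal_closedM.
Qed.
Lemma ideal_closed_sum (I : Type) (r : seq I) (P : pred I) F :
  (forall i, P i -> F i \in p) -> \sum_(i <- r | P i) F i \in p.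
Proof.
by move=> pF; elim/big_ind: _ => //; [exact: ideal_closed0 | exact: ideal_closedD].
Qed.

End IdealTheory.

Definition colon p x : {pred R} := [pred a | a * x \in p].

Lemma colon_ideal p x : ideal_closed p -> ideal_closed (colon p x).
Proof.
move=> idp; split=> [|a u v]; rewrite !inE.
  by rewrite mul0r; apply: ideal_closed0.
by rewrite mulrDl -mulrA => pu pv; apply: ideal_closedZD.
Qed.

(** Without a maximal member, dependent choice gives a strictly increasing chain. Its union is an
    ideal whose finitely many generators already lie in one member, where the chain would have to
    stop. *)
Lemma noetherian_max (F : {pred R} -> Prop) :
  noetherian R -> (forall p, F p -> ideal_closed p) -> (exists p, F p) ->
  exists2 p, F p & forall q, F q -> {subset p <= q} -> {subset q <= p}.
Proof.
move=> noeR Fid [p0 Fp0]; apply: contrapT => nomax.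
have step (p : {p | F p}) : exists q : {p | F p},
    {subset sval p <= sval q} /\ ~ {subset sval q <= sval p}.
  apply: contrapT => noq; apply: nomax; exists (sval p); first exact: svalP.
  move=> q Fq pq; apply: contrapT => nqp; apply: noq.
  by exists (exist _ q Fq).
have [next nextP] := boolp.choice step.
pose c n := sval (iter n next (exist _ p0 Fp0)).
have cid n : ideal_closed (c n) by apply/Fid/svalP.
have cS n : {subset c n <= c n.+1} by have [] := nextP (iter n next (exist _ p0 Fp0)).
have cle m n : (m <= n)%N -> {subset c m <= c n}.
  elim: n => [|n IH]; first by rewrite leqn0 => /eqP ->.
  by rewrite leq_eqVlt => /predU1P[-> //|/IH h] x /h /cS.
pose u : {pred R} := [pred x | `[< exists n, x \in c n >]].
have uid : ideal_closed u.
  split=> [|a x y /asboolP[m cx] /asboolP[n cy]]; apply/asboolP.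
    by exists 0%N; apply: ideal_closed0.
  exists (maxn m n); apply: ideal_closedZD => //.
    by apply: cle cx; rewrite leq_maxl.
  by apply: cle cy; rewrite leq_maxr.
have [s us] := noeR (submod_of uid).
have su x : x \in s -> exists n, x \in c n.
  by move=> sx; apply/asboolP; have := us x; rewrite (span_incl (S := [set` s])).
have [n sn] : exists n, {subset s <= c n}.
  elim: s su {us} => [|x s IH] su; first by exists 0%N.
  have [y sy|m sm] := IH; first by apply: su; rewrite inE sy orbT.
  have [n xn] := su x (mem_head _ _); exists (maxn m n) => y.
  rewrite inE => /predU1P[->|/sm ym]; last by apply: cle ym; rewrite leq_maxl.
  by apply: cle xn; rewrite leq_maxr.
have [_] := nextP (iter n next (exist _ p0 Fp0)); apply => x xS.
have : x \in span [set` s] by rewrite -us; apply/asboolP; exists n.+1.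
exact: (@span_sub _ _ _ (submod_of (cid n))).
Qed.

Definition prime_closed p := forall a b, a * b \in p -> a \in p \/ b \in p.

Lemma prime_avoid_inter p (ps : seq {pred R}) :
  (1 \notin p) -> prime_closed p ->
  (forall q, List.In q ps -> ideal_closed q /\ ~ {subset q <= p}) ->
  exists2 e, e \notin p & forall q, List.In q ps -> e \in q.
Proof.
move=> p1 pp; elim: ps => [|q ps IH] psP; first by exists 1.
have [r psr|e pe ee] := IH; first by apply: psP; right.
have [idq nqp] := psP q (or_introl erefl).
have [b qb pb] : exists2 b, b \in q & b \notin p.
  apply: contrapT => nb; apply: nqp => x qx; apply: contrapT => /negP px.
  by apply: nb; exists x.
exists (e * b).
  by apply/negP => /pp[]; apply/negP.
move=> r [<-|rps]; first exact: ideal_closedM.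
by rewrite mulrC; apply: ideal_closedM (ee _ rps); have [] := psP r (or_intror rps).
Qed.

(** Induction on the list: an [a] that avoids the tail but lies in [p] is corrected by adding an [e]
    that lies in [P] and in the whole tail but not in [p]. *)
Lemma prime_avoidance P (ps : seq {pred R}) :
  ideal_closed P ->
  (forall p, List.In p ps -> [/\ ideal_closed p, 1 \notin p & prime_closed p]) ->
  (forall p q, List.In p ps -> List.In q ps -> {subset q <= p} -> {subset p <= q}) ->
  (forall p, List.In p ps -> ~ {subset P <= p}) ->
  exists2 a, a \in P & forall p, List.In p ps -> a \notin p.
Proof.
move=> idP; elim: ps => [|p ps IH] psP inc nP.
  by exists 0 => //; exact: ideal_closed0.
have [q psq|q r psq psr|q psq|a Pa apn] := IH.
- by apply: psP; right.
- by apply: inc; right.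
- by apply: nP; right.
have [idp p1 pp] := psP p (or_introl erefl).
have [pa|/negP pa] := boolP (a \in p); last first.
  by exists a => // q [<-|/apn //]; apply/negP.
have [q [<-|psq]|e pe ee] := @prime_avoid_inter p (P :: ps) p1 pp.
- by split=> //; apply: nP; left.
- split; first by have [] := psP q (or_intror psq).
  (* If [q] were inside [p], the two would coincide, and [a], which lies in [p], would lie in
     [q]. *)
  move=> qp; have pq := inc p q (or_introl erefl) (or_intror psq) qp.
  by have /negP[] := apn q psq; apply: pq.
exists (a + e); first by apply: ideal_closedD Pa _ => //; apply: ee; left.
move=> q [<-|psq]; apply/negP => qae.
  have /negP[] := pe; rewrite -(addrK a e) [e + a]addrC.
  exact: ideal_closedB.
have /negP[] := apn q psq; rewrite -(addrK e a).
apply: ideal_closedB => //; first by have [] := psP q (or_intror psq).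
by apply: ee; right.
Qed.

(* Kaplansky: the maximal colon ideals [(Q : x)] with [x] outside [Q] are prime,
   and finitely many of them cover the zero divisors modulo [Q]. *)
Lemma annihilated_by_zero_divisors P Q :
  noetherian R -> ideal_closed P -> ideal_closed Q ->
  (forall a, a \in P -> exists2 x, x \notin Q & a * x \in Q) ->
  exists2 x, x \notin Q & forall a, a \in P -> a * x \in Q.
Proof.
move=> noeR idP idQ zd.
pose mx x := x \notin Q /\ forall y, y \notin Q ->
  {subset colon Q x <= colon Q y} -> {subset colon Q y <= colon Q x}.
have mx_ex z : z \notin Q -> exists2 x, mx x & {subset colon Q z <= colon Q x}.
  move=> Qz; pose F p := exists x, [/\ x \notin Q, {subset colon Q z <= colon Q x}
     & p = colon Q x].
  have [_ [x [_ _ ->]]||_ [x [Qx zx ->]] xmax] := @noetherian_max F noeR.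
    exact: colon_ideal.
    by exists (colon Q z), z; split.
  exists x => //; split=> // y Qy xy; apply: xmax => //.
  by exists y; split=> // a /zx /xy.
have mx1 x : mx x -> 1 \notin colon Q x by move=> [Qx _]; rewrite inE mul1r.
have mx_prime x : mx x -> prime_closed (colon Q x).
  move=> [Qx xmax] a b abQ.
  have [|/negP bx] := boolP (b \in colon Q x); [by right | left].
  (* The ideal [(Q : b x)] contains [(Q : x)], so the two are equal by maximality, and [a] lies in
     the former. *)
  apply: (xmax (b * x)); first exact/negP.
    by move=> c; rewrite !inE => cx; rewrite mulrCA; apply: ideal_closedM.
  by move: abQ; rewrite !inE mulrA.
(* A largest ideal generated by finitely many elements satisfying [mx] contains all such elements,
   since adjoining one more does not enlarge it. *)
pose F p := exists2 t : seq R^o, (forall x, x \in t -> mx x) & p = span [set` t].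
have [||_ [t tmx ->] tmax] := @noetherian_max F noeR.
- by move=> _ [t _ ->]; apply: span_submod_closed.
- by exists (span [set` ([::] : seq R^o)]); exists [::].
have tgen x : mx x -> x \in (span [set` t] : {pred R^o}).
  move=> mxx; apply: (tmax (span [set` (x :: t : seq R^o)])).
  - by exists (x :: t) => // y; rewrite inE => /predU1P[->|/tmx].
  - apply: (@span_sub _ _ _ (span [set` (x :: t : seq R^o)])) => y ty.
    by apply: span_incl; rewrite /= inE; apply/orP; right.
  - by apply: span_incl; rewrite /= mem_head.
have mapIn q : List.In q [seq colon Q x | x <- t] -> exists2 x, x \in t & q = colon Q x.
  elim: (t) => //= x s IH [<-|/IH[y sy ->]]; first by exists x; rewrite ?mem_head.
  by exists y; rewrite // inE sy orbT.
have Inmap x : x \in t -> List.In (colon Q x) [seq colon Q x | x <- t].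
  elim: (t) => //= y s IH; rewrite inE => /predU1P[->|/IH]; by [left | right].
have tcover a : a \in P -> exists2 x, x \in t & a \in colon Q x.
  move=> /zd[z Qz azQ]; have [x0 mx0 zx0] := mx_ex z Qz.
  have ax0 : a \in colon Q x0 by apply: zx0.
  apply: contrapT => nt.
  (* Some [(Q : x)] with [x] in [t] lies in [(Q : x0)], hence equals it. Otherwise an [e] outside
     [(Q : x0)] would send all of [t] into [Q], and with it [x0], which is in the span of [t]. *)
  have [_ /mapIn[x tx ->]|e ex0 ee] :=
      prime_avoid_inter (ps := [seq colon Q x | x <- t]) (mx1 _ mx0) (mx_prime _ mx0).
    split; first exact: colon_ideal.
    move=> xx0; apply: nt; exists x => //.
    by have [_ xmax] := tmx x tx; have [Qx0 _] := mx0; apply: (xmax x0).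
  have /negP[] := ex0.
  rewrite inE; refine (span_ind (V := R^o) (Q := fun z => (e * z : R) \in Q)
    _ _ _ (tgen x0 mx0)) => [|b u v|y ty].
  - by rewrite mulr0; apply: ideal_closed0.
  - move=> eu ev; rewrite mulrDr [e * _]mulrCA.
    by apply: ideal_closedZD.
  - exact: ee _ (Inmap y ty).
(* Otherwise none of the primes [(Q : x)] contains [P], and prime avoidance yields an element of [P]
   outside all of them, against [tcover]. *)
apply: contrapT => noP.
have [|||a Pa apn] := @prime_avoidance P [seq colon Q x | x <- t] idP.
- move=> _ /mapIn[x /tmx mxx ->]; split; [exact: colon_ideal | exact: mx1 | exact: mx_prime].
- move=> _ _ /mapIn[x /tmx [Qx _] ->] /mapIn[y /tmx[_ ymax] ->]; exact: ymax.
- move=> _ /mapIn[x /tmx[Qx _] ->] Px; apply: noP; exists x => //.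
have [x tx] := tcover a Pa; apply/negP/apn/Inmap/tx.
Qed.

End Noetherian.

(** * Hilbert's basis theorem *)

Section HilbertBasis.
Variable A : comNzRingType.

(** Multiplying each [f] by a power of the variable moves its leading coefficient to degree [d],
    where linear combinations can be formed. *)
Lemma lead_coef_span (s : seq {poly A}) d b :
  (forall f, f \in s -> f != 0 /\ (size f <= d.+1)%N) ->
  b \in span [set` (map lead_coef s : seq A^o)] ->
  exists g, [/\ g \in span [set` (s : seq {poly A}^o)], (size g <= d.+1)%N & g`_d = b].
Proof.
move=> sP; apply: (span_ind (V := A^o) (Q := fun b => exists g,
  [/\ g \in span [set` (s : seq {poly A}^o)], (size g <= d.+1)%N & g`_d = b])).
- by exists 0; rewrite coef0 size_poly0; split=> //; apply: rpred0.
- move=> a u v [g [gs sg <-]] [h [hs sh <-]]; exists (a%:P * g + h); split.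
  + by rewrite rpredD //; apply: (rpredZ (a%:P : {poly A})).
  + apply: leq_trans (size_polyD _ _) _; rewrite geq_max sh andbT mul_polyC.
    exact: leq_trans (size_scale_leq _ _) sg.
  + by rewrite coefD coefCM.
- move=> _ /mapP[f fs ->]; have [f0 sf] := sP f fs.
  have sf0 : (0 < size f)%N by rewrite size_poly_gt0.
  exists ('X^(d.+1 - size f) * f); split.
  + by apply: (rpredZ ('X^(d.+1 - size f) : {poly A})); apply: span_incl.
  + apply: leq_trans (size_polyMleq _ _) _; rewrite size_polyXn.
    by rewrite addSn /= subnK.
  + rewrite coefXnM ifF; last by apply/negbTE; rewrite -leqNgt leq_subLR -add1n leq_add2r.
    by rewrite lead_coefE; congr (_`_ _); rewrite -(prednK sf0) subSS subKn // -ltnS prednK.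
Qed.

(** If [J] is not finitely generated, choose repeatedly an element of [J] of least size outside the
    ideal of the previous ones. The ideals of leading coefficients stop growing, so some choice can
    be reduced by the previous ones to a smaller size. *)
Lemma noetherian_poly : noetherian A -> noetherian {poly A}.
Proof.
move=> noeA J; apply: contrapT => nfg.
pose sp (s : seq {poly A}) : {pred {poly A}} := span [set` (s : seq {poly A}^o)].
pose good (s : seq {poly A}) := {subset s <= J}.
have sp_sub s : good s -> {subset sp s <= J}.
  by move=> gs; exact: (@span_sub _ {poly A}^o [set` (s : seq {poly A}^o)] J).
have step (s : {s | good s}) : exists f, [/\ f \in J, f \notin sp (sval s)
    & forall g, g \in J -> g \notin sp (sval s) -> (size f <= size g)%N].
  case: s => s gs /=.
  have ex : exists n, `[< exists f, [/\ f \in J, f \notin sp s & size f = n] >].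
    apply: contrapT => nex; apply: nfg; exists s => x.
    apply/idP/idP => [Jx|]; last exact: (sp_sub s gs x).
    by apply: contrapT => /negP xs; apply: nex; exists (size x); apply/asboolP; exists x.
  case: (ex_minnP ex) => n /asboolP[f [Jf fs <-]] nmin.
  exists f; split=> // g Jg gs'; apply: nmin; apply/asboolP.
  by exists g.
have [F FP] := boolp.choice step.
have goodF (s : {s | good s}) : good (F s :: sval s).
  move=> g; rewrite inE => /predU1P[->|]; last exact: (svalP s g).
  by have [] := FP s.
have good0 : good [::] by [].
(* [c n] lists the first [n] chosen polynomials, latest first, and [F (c n)] is the next one. *)
pose c n := iter n (fun s => exist good _ (goodF s)) (exist good [::] good0).
have cS n : sval (c n.+1) = F (c n) :: sval (c n) by [].
have szF m n : (m <= n)%N -> (size (F (c m)) <= size (F (c n)))%N.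
  elim: n => [|n IH]; first by rewrite leqn0 => /eqP ->.
  rewrite leq_eqVlt => /predU1P[-> //|/IH h]; apply: leq_trans h _.
  have [_ _ Fmin] := FP (c n); have [JF nF _] := FP (c n.+1).
  apply: Fmin => //; apply: contra nF; rewrite cS.
  apply: (@span_sub _ _ _ (span [set` (F (c n) :: sval (c n) : seq {poly A}^o)])) => f fs.
  by apply: span_incl; rewrite /= inE; apply/orP; right.
have memc n f : f \in sval (c n) -> exists2 m, (m < n)%N & f = F (c m).
  elim: n => // n IH; rewrite cS inE => /predU1P[->|/IH[m mn ->]]; first by exists n.
  by exists m => //; apply: leqW.
pose L n : {pred A} := span [set` (map lead_coef (sval (c n)) : seq A^o)].
pose FL p := exists n, p = L n.
have [||_ [n ->] nmax] := @noetherian_max A FL noeA.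
- by move=> _ [n ->]; apply: span_submod_closed.
- by exists (L 0%N), 0%N.
set f := F (c n); have [Jf nf fmin] := FP (c n); rewrite -/f in Jf nf fmin.
have f0 : f != 0 by apply: contraNneq nf => ->; apply: rpred0.
have sf0 : (0 < size f)%N by rewrite size_poly_gt0.
have lf : lead_coef f \in L n.
  apply: (nmax (L n.+1)); first by exists n.+1.
    apply: (@span_sub _ _ _ (span [set` (map lead_coef (sval (c n.+1)) : seq A^o)])) => b bs.
    by apply: span_incl; rewrite /= inE; apply/orP; right.
  by apply: span_incl; rewrite /= mem_head.
have [|g [gs sg gf]] := @lead_coef_span (sval (c n)) (size f).-1 (lead_coef f) _ lf.
  move=> h hc; have [m mn ->] := memc _ _ hc; rewrite prednK //; split; last exact/szF/ltnW.
  have [_ nh _] := FP (c m); apply: contraNneq nh => ->; exact: rpred0.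
rewrite prednK // in sg.
have Jfg : f - g \in J.
  apply: (ideal_closedB (submodClosedP J)) => //.
  by apply: sp_sub gs; apply: (svalP (c n)).
(* [f - g] is still a candidate for the choice after [c n], yet the top coefficient of [f] cancels
   in it. *)
have /(fmin _ Jfg) : f - g \notin sp (sval (c n)).
  apply: contra nf => fg; rewrite -(subrK g f).
  exact: (@rpredD _ (span [set` (sval (c n) : seq {poly A}^o)])).
rewrite leqNgt -(prednK sf0) ltnS => /negP; apply.
apply/leq_sizeP => j; rewrite leq_eqVlt => /predU1P[<-|].
  by rewrite coefB gf lead_coefE subrr.
rewrite prednK // => fj; rewrite coefB !nth_default ?subrr //.
exact: leq_trans fj.
Qed.

Lemma noetherian_surj (B : comNzRingType) (f : {rmorphism A -> B}) :
  (forall y, exists x, f x = y) -> noetherian A -> noetherian B.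
Proof.
move=> fsurj noeA J.
pose p : {pred A^o} := [pred x | f x \in J].
have idp : ideal_closed p.
  have idJ : ideal_closed J := submodClosedP J.
  split=> [|a u v]; rewrite !inE ?rmorph0; first exact: ideal_closed0.
  by move=> Ju Jv; rewrite rmorphD rmorphM; apply: ideal_closedZD.
have [s ps] := noeA (submod_of idp).
exists (map f s) => y; apply/idP/idP.
  have [x <-] := fsurj y; have -> : (f x \in J) = (x \in span [set` s]) := ps x.
  pose fs : {pred B} := span [set` (map f s : seq B^o)].
  have idf : ideal_closed fs by exact: span_submod_closed.
  apply: (span_ind (V := A^o) (Q := fun x : A^o => f x \in fs)).
  - by rewrite rmorph0; apply: ideal_closed0.
  - by move=> a u v fu fv; rewrite rmorphD rmorphM; apply: ideal_closedZD.
  - by move=> x' xs; apply: span_incl => /=; apply: map_f.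
apply: span_sub => _ /mapP[x xs ->].
by have -> : (f x \in J) = (x \in span [set` s]) := ps x; apply: span_incl.
Qed.

End HilbertBasis.

Lemma noetherian_field (K : fieldType) : noetherian K.
Proof.
move=> J; have [[x Jx x0]|J0] := pselect (exists2 x, x \in J & x != 0).
  exists [:: 1] => y; apply/idP/idP => _.
    rewrite -[y]mulr1; apply: (rpredZ (y : K)); apply: span_incl; exact: mem_head.
  by rewrite -(mulfVK x0 y); apply: (rpredZ (y / x : K)).
exists [::] => x; apply/idP/idP => [Jx|].
  have [->|x0] := eqVneq x 0; first exact: rpred0.
  by case: J0; exists x.
by apply: span_sub => y; rewrite /= in_nil.
Qed.

(** Adjoining one polynomial variable to [K] per generator gives a noetherian ring that maps onto
    [R]. *)
Lemma noetherian_fg_algebra (K : fieldType) (R : comAlgType K) (s : seq R) :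
  (forall B : subalgClosed R, {subset s <= B} -> forall x, x \in B) ->
  noetherian R.
Proof.
move=> gen.
(* [A] is only a ring, so the presence of the scalars in the image of [f] is carried along; it makes
   the image a subalgebra. *)
have [A noeA [f [fK fs]]] : exists2 A : comNzRingType, noetherian A &
    exists f : {rmorphism A -> R}, (forall a : K, exists x, f x = a%:A) /\
      forall y, y \in s -> exists x, f x = y.
  elim: s {gen} => [|y s [A noeA [f [fK fs]]]].
    exists K; first exact: noetherian_field.
    by exists (in_alg R); split=> // a; exists a.
  have cfu : commr_rmorph f y by move=> x; apply: mulrC.
  exists {poly A}; first exact: noetherian_poly.
  exists (horner_morph cfu); split=> [a|z].
    by have [x fx] := fK a; exists x%:P; rewrite /= horner_morphC.
  rewrite inE => /predU1P[->|/fs[x fx]]; first by exists 'X; rewrite /= horner_morphX.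
  by exists x%:P; rewrite /= horner_morphC.
pose p : {pred R} := [pred y | `[< exists x, f x = y >]].
have palg : GRing.subalg_closed p.
  split=> [|a u v /asboolP[x <-] /asboolP[y <-]|u v /asboolP[x <-] /asboolP[y <-]];
    apply/asboolP.
  - by exists 1; rewrite rmorph1.
  - by have [b fb] := fK a; exists (b * x + y); rewrite rmorphD rmorphM fb mulr_algl.
  - by exists (x * y); rewrite rmorphM.
pose B : subalgClosed R := HB.pack p (GRing.isSubalgClosed.Build K R p palg).
apply: (noetherian_surj (f := f)) noeA => y.
by apply/asboolP; apply: (gen B) => z zs; apply/asboolP/fs.
Qed.

(** * Depth zero and localization *)

Section Powers.
Variable R : comNzRingType.
Implicit Types I P : {pred R}.

Lemma prod_ipow I k (s : seq R) : size s = k ->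
  {subset s <= I} -> \prod_(a <- s) a \in ipow I k.
Proof. by move=> <- sI; apply: span_incl; exists (in_tuple s). Qed.

Lemma ipowSM I k a b : a \in I -> b \in ipow I k -> a * b \in ipow I k.+1.
Proof.
move=> Ia; apply: (span_ind (V := R^o) (Q := fun b : R^o => a * b \in ipow I k.+1)).
- by rewrite mulr0; apply: rpred0.
- move=> c u v Iu Iv; rewrite mulrDr [a * _]mulrCA.
  exact: (ideal_closedZD (submodClosedP (ipow I k.+1))).
- move=> _ [s sI ->].
  have -> : a * (\prod_(c <- s) c) = \prod_(c <- a :: s) c by rewrite big_cons.
  apply: prod_ipow => [|x]; first by rewrite /= size_tuple.
  by rewrite inE => /predU1P[->|/sI].
Qed.

Lemma ipow0_1 I : 1 \in ipow I 0.
Proof. by have := @prod_ipow I 0 [::] erefl; rewrite big_nil; apply. Qed.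

Lemma ipow_exp I k a : a \in I -> a ^+ k \in ipow I k.
Proof.
move=> Ia; elim: k => [|k IH]; first exact: ipow0_1.
by rewrite exprS; apply: ipowSM.
Qed.

Lemma ipow_sub I P k : ideal_closed P -> {subset I <= P} -> (0 < k)%N ->
  {subset ipow I k <= P}.
Proof.
move=> idP IP; case: k => // k _; apply: (@span_sub _ _ _ (submod_of idP)) => _ [s sI ->].
case/tupleP: s sI => a s sI; rewrite big_cons mulrC.
by apply: (ideal_closedM idP); apply/IP/sI/mem_head.
Qed.

End Powers.

Lemma enat_le0 x : enat_le x (Some 0%N) -> x = Some 0%N.
Proof. by case: x => //= n; rewrite leqn0 => /eqP ->. Qed.

Section Depth.
Variable R : comNzRingType.

Lemma quotmod_proj_eq0 (V : lmodType R) (W : submodClosed V) x :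
  (quotmod_proj W x == 0) = (x \in W).
Proof.
rewrite -[0 in LHS](raddf0 (quotmod_proj W)) quotmod_projE.
by rewrite subr0.
Qed.

Lemma quotmod_proj_eq0P (V : lmodType R) (W : submodClosed V) x :
  quotmod_proj W x = 0 <-> x \in W.
Proof. by rewrite -quotmod_proj_eq0; split=> [->|/eqP]. Qed.

Lemma quotmod_projZ (V : lmodType R) (W : submodClosed V) (a : R) x :
  a *: quotmod_proj W x = quotmod_proj W (a *: x).
Proof. exact: quotmod_proj_scale. Qed.

Lemma Ass_quotmod (J : submodClosed R^o) (P : prime_idealr R) :
  Ass (quotmod J) P <-> exists x : R, forall a : R, a \in P <-> a * x \in J.
Proof.
split=> [[z zP]|[x xP]].
  have [x zx] := quotmod_projP z; exists x => a; rewrite zP zx quotmod_projZ.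
  exact: quotmod_proj_eq0P.
exists (quotmod_proj J x) => a; rewrite xP quotmod_projZ.
exact: iff_sym (quotmod_proj_eq0P _ _).
Qed.

Variables (n : {pred R}) (J : submodClosed R^o).
Hypotheses (idn : ideal_closed n) (n1 : 1 \notin n) (Jn : {subset J <= n}).

(** Every element of [(s)(R/J)] has a representative in [n], and [n] contains [J] but not 1. This
    gives the nonvanishing clause of [regular_seq]. *)
Lemma seqmul_quotmod_proper (s : seq R) : {subset s <= n} ->
  quotmod_proj J 1 \notin seqmul (quotmod J) s.
Proof.
move=> sn; apply: contra n1 => h1.
have [b nb] : exists2 b, b \in n & quotmod_proj J 1 = quotmod_proj J b.
  refine (span_ind (V := quotmod J)
    (Q := fun z => exists2 b, b \in n & z = quotmod_proj J b) _ _ _ h1).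
  - by exists 0; [exact: ideal_closed0 | rewrite raddf0].
  - move=> a _ _ [b nb ->] [c nc ->]; exists (a * b + c); first exact: ideal_closedZD.
    by rewrite raddfD /= quotmod_projZ.
  - move=> _ [a sa [z ->]]; have [x ->] := quotmod_projP z; exists (x * a).
      exact/(ideal_closedM idn)/sn.
    by rewrite quotmod_projZ mulrC.
move=> /eqP; rewrite quotmod_projE => /Jn nb1.
by rewrite -(subrK b 1); apply: ideal_closedD.
Qed.

(** A nonzerodivisor in [n] is by itself a regular sequence; conversely, the first term of a
    nonempty regular sequence is a nonzerodivisor. *)
Lemma depth_eq0 :
  depth n (quotmod J) = Some 0%N <->
  forall x, x \in n -> exists2 y, y \notin J & x * y \in J.
Proof.
split=> [d0 x nx|zd].
  apply: contrapT => nzd.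
  suff reg : regular_seq (quotmod J) [:: x].
    have : enat_le (Some 1%N) (depth n (quotmod J)).
      apply: enat_sup_ub; exists [:: x] => //; split=> // y.
      by rewrite inE => /eqP ->.
    by rewrite d0.
  split.
    case=> [_ y|//]; have [z ->] := quotmod_projP y; have [w ->] := quotmod_projP z.
    rewrite /= quotmod_projZ quotmod_projZ => /eqP; rewrite quotmod_proj_eq0 => xw.
    (* The first regularity condition is taken modulo [seqmul] of the empty sequence, which is the
       zero submodule. *)
    have {}xw : quotmod_proj J (x * w) = 0.
      refine (span_ind (V := quotmod J) (Q := fun z => z = 0) _ _ _ xw) => //.
        by move=> a u v -> ->; rewrite scaler0 addr0.
      by move=> t [a].
    suff -> : quotmod_proj J w = 0 by apply: raddf0.
    apply/eqP; rewrite quotmod_proj_eq0; apply: contrapT => /negP wJ; apply: nzd.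
    by exists w => //; apply/quotmod_proj_eq0P.
  exists (quotmod_proj _ (quotmod_proj J 1)); rewrite quotmod_proj_eq0.
  by apply: seqmul_quotmod_proper => y; rewrite inE => /eqP ->.
apply/enat_le0/enat_sup_least => _ [s [sn [reg _]] <-].
case: s sn reg => // x s sn /(_ 0%N erefl) /= reg.
have [w wJ xw] := zd x (sn x (mem_head _ _)).
have /reg/eqP : x *: quotmod_proj (seqmul (quotmod J) [::]) (quotmod_proj J w) = 0.
  apply/eqP; rewrite !quotmod_projZ quotmod_proj_eq0.
  have /eqP -> : quotmod_proj J (x *: (w : R^o)) == 0 by rewrite quotmod_proj_eq0.
  exact: rpred0.
rewrite quotmod_proj_eq0 => w0; have /eqP : quotmod_proj J w = 0.
  refine (span_ind (V := quotmod J) (Q := fun z => z = 0) _ _ _ w0) => //.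
    by move=> a u v -> ->; rewrite scaler0 addr0.
  by move=> t [a].
by rewrite quotmod_proj_eq0 (negbTE wJ).
Qed.

End Depth.

Section Localization.
Variables (R : comNzRingType) (P : prime_idealr R).

Lemma prime_ideal_closed : ideal_closed P.
Proof.
split=> [|a x y Px Py]; first exact: rpred0.
by rewrite rpredD // prime_idealrM Px orbT.
Qed.

Lemma loc_scaleE (a b : R) (s t : denom P) :
  (mkloc a s : loc P) *: (mkloc b t : (loc P)^o) = mkloc (a * b) (denomM s t).
Proof. exact: loc_mulE. Qed.

(** Every element of the extension is a single fraction with numerator in [J]; equality of fractions
    then supplies the multiplier [u]. *)
Lemma mem_loc_ext (J : {pred R}) a s : ideal_closed J ->
  mkloc a s \in loc_ext P J <-> exists2 u, u \notin P & u * a \in J.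
Proof.
move=> idJ; split=> [h|[u Pu Jua]].
  have [b [t [ab Jb]]] : exists b t, mkloc a s = mkloc b t :> loc P /\ b \in J.
    refine (span_ind (V := (loc P)^o)
      (Q := fun z => exists b t, z = mkloc b t :> loc P /\ b \in J) _ _ _ h).
    - by exists 0, (denom1 P); split=> //; apply: ideal_closed0.
    - move=> c _ _ [x [t [-> Jx]]] [y [r [-> Jy]]]; have [b [w ->]] := loc_ind c.
      exists (b * x * sval r + y * sval (denomM w t)), (denomM (denomM w t) r); split.
        by rewrite loc_scaleE; apply: loc_addE.
      rewrite [_ * sval r]mulrC [y * _]mulrC; apply: (ideal_closedZD idJ).
        exact: ideal_closedM.
      exact: ideal_closedM.
    - by move=> _ [b Jb <-]; exists b, (denom1 P).
  have [u e] := (mklocP a s b t).1 ab.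
  exists (sval u * sval t); first exact: mul_notin.
  have -> : sval u * sval t * a =
      sval u * (a * sval t - b * sval s) + sval u * sval s * b by ring.
  by rewrite e add0r; apply: ideal_closedM.
pose v : denom P := exist _ u Pu.
have -> : mkloc a s = (mkloc 1 (denomM v s) : loc P) *: (mkloc (u * a) (denom1 P) : (loc P)^o).
  by rewrite loc_scaleE; apply: mkloc_eq => /=; ring.
by apply: rpredZ; apply: span_incl; exists (u * a).
Qed.

Lemma mem_loc_max a s : mkloc a s \in @loc_max R P <-> a \in P.
Proof.
rewrite (mem_loc_ext _ _ prime_ideal_closed); split=> [[u Pu]|Pa].
  by rewrite prime_idealrM (negbTE Pu).
by exists 1; rewrite ?mul1r // idealr1.
Qed.

Lemma loc_max1 : 1 \notin @loc_max R P.
Proof. by apply/negP => /(mem_loc_max 1 (denom1 P)).1; rewrite idealr1. Qed.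

Lemma loc_ext_sub (J J' : {pred R}) : {subset J <= J'} ->
  {subset loc_ext P J <= loc_ext P J'}.
Proof.
by move=> JJ'; apply: span_sub => _ [a Ja <-]; apply: span_incl; exists a => //; apply: JJ'.
Qed.

Lemma mkloc1M (a b : R) :
  mkloc (a * b) (denom1 P) = mkloc a (denom1 P) * mkloc b (denom1 P).
Proof. by rewrite [RHS]loc_mulE; apply: mkloc_eq => /=; ring. Qed.

Lemma mkloc1D (a b : R) :
  mkloc (a + b) (denom1 P) = mkloc a (denom1 P) + mkloc b (denom1 P).
Proof. by rewrite [RHS]loc_addE; apply: mkloc_eq => /=; ring. Qed.

(** Needed because [depth_function] is about the extension of a power, and [dstab_loc] about a power
    of the extension. *)
Lemma loc_ext_ipow (I : {pred R}) k : ideal_closed I ->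
  loc_ext P (ipow I k) =i ipow (loc_ext P I) k.
Proof.
move=> idI z; apply/idP/idP.
  apply: span_sub => _ [a + <-] => Ia.
  pose J : {pred loc P} := ipow (loc_ext P I) k; have idJ : ideal_closed J := submodClosedP _.
  refine (span_ind (V := R^o)
    (Q := fun a : R^o => mkloc (R := R) a (denom1 P) \in J) _ _ _ Ia).
  - exact: ideal_closed0 idJ.
  - by move=> b u v Ju Jv; rewrite mkloc1D mkloc1M; apply: ideal_closedZD.
  - move=> _ [s sI ->].
    have -> : mkloc (\prod_(b <- s) b) (denom1 P)
      = \prod_(c <- [seq (mkloc b (denom1 P) : loc P) | b <- s]) c.
      rewrite big_map; elim: (tval s) => [|b t IH]; first by rewrite !big_nil.
      by rewrite !big_cons mkloc1M IH.
    apply: prod_ipow; first by rewrite size_map size_tuple.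
    move=> _ /mapP[b bs ->]; apply: span_incl; exists b => //.
    exact: sI.
apply: span_sub => _ [s sI ->].
suff [a [t [-> Ia]]] : exists a t, \prod_(c <- s) c = mkloc a t :> loc P
    /\ a \in ipow I (size s).
  rewrite size_tuple in Ia; apply/(mem_loc_ext _ _ (submodClosedP _)).
  by exists 1; rewrite ?mul1r // idealr1.
have {}sI : {subset (tval s : seq (loc P)) <= loc_ext P I} := sI.
elim: (tval s : seq (loc P)) sI => [|c l IH] lI.
  by exists 1, (denom1 P); rewrite big_nil; split=> //; apply: ipow0_1.
have [x xl|a [t [e Ia]]] := IH; first by apply: lI; rewrite inE xl orbT.
have [b [r cb]] := loc_ind c.
have := lI c (mem_head _ _); rewrite [X in X \in _]cb => /(mem_loc_ext _ _ idI)[u Pu Iub].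
exists (u * b * a), (denomM (denomM (exist _ u Pu) r) t); split; last exact: ipowSM.
rewrite big_cons e cb [LHS]loc_mulE; apply: mkloc_eq => /=; ring.
Qed.

Lemma Ass_subset (J : submodClosed R^o) : Ass (quotmod J) P -> {subset J <= P}.
Proof.
move=> /Ass_quotmod[x xP] a Ja; apply/xP; rewrite mulrC.
exact: (ideal_closedM (submodClosedP J)).
Qed.

(** Leaving [W] free covers both the extension of a power and the power of an extension. If [P R_P]
    consists of zero divisors, [P x] lies in the contraction of [J R_P] for some [x] outside it;
    clearing denominators gives [P = (J : u x)]. *)
Lemma depth_loc_eq0 (J : submodClosed R^o) (W : submodClosed (loc P)^o) :
  noetherian R -> W =i loc_ext P J -> {subset J <= P} ->
  depth (@loc_max R P) (quotmod W) = Some 0%N <-> Ass (quotmod J) P.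
Proof.
move=> noeR WE JP; have idJ : ideal_closed J := submodClosedP _.
have WP : {subset W <= @loc_max R P} by move=> z; rewrite WE; apply: loc_ext_sub.
rewrite (depth_eq0 (submodClosedP (loc_ext P P)) loc_max1 WP) Ass_quotmod.
split=> [zd|[x xP] z].
  pose Q : {pred R} := [pred a | mkloc a (denom1 P) \in loc_ext P J].
  have memQ a : a \in Q <-> exists2 u, u \notin P & u * a \in J.
    exact: mem_loc_ext.
  have idQ : ideal_closed Q.
    pose L : {pred loc P} := loc_ext P J.
    have idL : ideal_closed L := submodClosedP _.
    have QE a : (a \in Q) = (mkloc a (denom1 P) \in L) by [].
    split=> [|a u v]; rewrite !QE; first exact: (ideal_closed0 idL).
    by move=> Qu Qv; rewrite mkloc1D mkloc1M; apply: ideal_closedZD.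
  have [a Pa|x Qx xP] := annihilated_by_zero_divisors noeR prime_ideal_closed idQ.
    have [|z Wz az] := zd (mkloc a (denom1 P)).
      exact/mem_loc_max.
    have [b [s zb]] := loc_ind z; subst z; exists b.
      apply: contra Wz => /memQ h; rewrite WE; exact/mem_loc_ext.
    apply/memQ; move: az; rewrite WE [_ * _]loc_mulE; exact: (mem_loc_ext _ _ idJ).1.
  have [s Ps] := noeR (submod_of prime_ideal_closed).
  (* Each of the finitely many generators of [P] has its own multiplier; their product serves them
     all. *)
  have [u Pu us] : exists2 u, u \notin P & forall a, a \in s -> u * (a * x) \in J.
    have sP : {subset s <= P}.
      move=> a sa; have -> : (a \in P) = (a \in span [set` s]) := Ps a.
      exact: span_incl.
    elim: s sP {Ps} => [|a s IH] sP; first by exists 1 => //; rewrite idealr1.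
    have [c cs|u Pu us] := IH; first by apply: sP; rewrite inE cs orbT.
    have [v Pv va] := (memQ _).1 (xP a (sP a (mem_head _ _))).
    exists (u * v); first by rewrite prime_idealrM negb_or Pu.
    move=> c; rewrite inE => /predU1P[->|/us uc].
      by rewrite -mulrA; apply: ideal_closedM.
    by rewrite [u * v]mulrC -mulrA; apply: ideal_closedM.
  exists (u * x) => a; split=> [Pa|Ja].
    rewrite mulrCA; have : a \in span [set` s] by rewrite -Ps.
    apply: (span_ind (V := R^o) (Q := fun a : R^o => u * ((a : R) * x) \in J)) => //.
      by rewrite mul0r mulr0; apply: ideal_closed0 idJ.
    move=> c b d ub ud; rewrite mulrDl mulrDr -mulrA mulrCA; exact: ideal_closedZD.
  (* If [a] were outside [P], the multiplier [a * u] would put [x] in [Q]. *)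
  apply: contrapT => /negP Pa; case/negP: Qx; apply/memQ.
  by exists (a * u); rewrite -?mulrA // prime_idealrM negb_or Pa.
have [a [s ->]] := loc_ind z => /mem_loc_max Pa; exists (mkloc x (denom1 P)).
  apply/negP; rewrite WE => /(mem_loc_ext _ _ idJ)[u /negP Pu ux]; apply: Pu.
  exact/xP.
rewrite WE [_ * _]loc_mulE; apply/(mem_loc_ext _ _ idJ).
exists 1; first by rewrite idealr1.
by rewrite mul1r; apply/xP.
Qed.

End Localization.

(** * Graded ideals *)

Section Graded.
Variables (K : fieldType) (R : comAlgType K) (gr : nat -> submodClosed R).
Hypothesis std : standard_graded gr.

(* The decomposition of [x] into homogeneous components [x_i] is encoded by the
   polynomial [\sum_i x_i 'X^i], whose value at 1 is [x]. *)
Definition graded_poly (p : {poly R}) := forall i, p`_i \in gr i.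

Lemma graded_polyD p q : graded_poly p -> graded_poly q -> graded_poly (p + q).
Proof. by move=> gp gq i; rewrite coefD rpredD. Qed.

Lemma graded_polyB p q : graded_poly p -> graded_poly q -> graded_poly (p - q).
Proof. by move=> gp gq i; rewrite coefB -scaleN1r rpredD ?rpredZ. Qed.

Lemma graded_polyM p q : graded_poly p -> graded_poly q -> graded_poly (p * q).
Proof.
case: std => _ _ grM _ _ gp gq i; rewrite coefM; apply: rpred_sum => j _.
have := grM _ _ _ _ (gp j) (gq (i - j)%N).
by rewrite subnKC // -ltnS.
Qed.

Lemma graded_poly_ex x : exists2 p, graded_poly p & p.[1] = x.
Proof.
case: std => + _ _ _ _ => /(_ x)[c [n cgr ->]]; exists (\poly_(i < n) c i).
  by move=> i; rewrite coef_poly; case: ifP => // _; apply: rpred0.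
by rewrite horner_poly; apply: eq_bigr => i _; rewrite expr1n mulr1.
Qed.

Lemma graded_poly_uniq p q :
  graded_poly p -> graded_poly q -> p.[1] = q.[1] -> p = q.
Proof.
move=> gp gq pq; apply/eqP; rewrite -subr_eq0; apply/eqP.
have gpq := graded_polyB gp gq; have : (p - q).[1] = 0 by rewrite hornerD hornerN pq subrr.
move: (p - q) gpq => r gr_r; rewrite horner_coef => r0.
case: std => _ /(_ (fun i => r`_i) (size r) gr_r) indep _ _ _.
apply/polyP => i; rewrite coef0; have [ri|] := ltnP i (size r); last exact: nth_default.
apply: indep ri; rewrite -[RHS]r0; apply: eq_bigr => j _.
by rewrite expr1n mulr1.
Qed.

(** For ideals this is equivalent to [graded_ideal]; it is the form that passes to powers and
    associated primes. *)
Definition has_components (J : {pred R}) := forall p, graded_poly p ->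
  p.[1] \in J -> forall i, p`_i \in J.

Lemma has_componentsI (J : {pred R}) :
  (forall x, x \in J -> exists p, [/\ graded_poly p, p.[1] = x & forall i, p`_i \in J]) ->
  has_components J.
Proof.
by move=> Jex p gp /Jex[q [gq qp Jq]] i; rewrite (graded_poly_uniq gp gq (esym qp)).
Qed.

Lemma graded_has_components (J : {pred R}) : ideal_closed J ->
  graded_ideal gr J -> has_components J.
Proof.
move=> idJ gJ; apply: has_componentsI => x /gJ.
apply: (span_ind (V := R^o) (Q := fun x : R^o =>
  exists p, [/\ graded_poly p, p.[1] = x & forall i, p`_i \in J])).
- by exists 0; split=> [i||i]; rewrite ?horner0 // coef0 ?rpred0 //; apply: ideal_closed0.
- move=> a u v [p [gp <- Jp]] [q [gq <- Jq]]; have [r gr_r <-] := graded_poly_ex a.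
  exists (r * p + q); split.
  + exact/graded_polyD/gq/graded_polyM.
  + by rewrite hornerD hornerM.
  + move=> i; rewrite coefD; apply: ideal_closedD => //; rewrite coefM.
    by apply: ideal_closed_sum => // j _; apply: ideal_closedM.
- move=> h [Jh [d hd]]; exists (h *: 'X^d); split.
  + move=> i; rewrite coefZ coefXn; case: eqP => [->|_]; first by rewrite mulr1.
    by rewrite mulr0 rpred0.
  + by rewrite hornerZ hornerXn expr1n mulr1.
  + by move=> i; rewrite coefZ mulrC; apply: ideal_closedM.
Qed.

Lemma has_components_graded (J : {pred R}) : ideal_closed J ->
  has_components J -> graded_ideal gr J.
Proof.
move=> idJ cJ x; split; last first.
  by apply: (@span_sub _ _ _ (submod_of idJ)) => h [].
have [p gp <-] := graded_poly_ex x => /(cJ p gp) Jp; rewrite horner_coef.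
apply: (@rpred_sum R^o) => i _; rewrite expr1n mulr1; apply: span_incl.
by split=> //; exists i.
Qed.

(** A product of elements of [I] is encoded by the product of their polynomials, whose coefficients
    are sums of products of components, all in [I]. *)
Lemma ipow_has_components (I : {pred R}) k : has_components I ->
  has_components (ipow I k).
Proof.
move=> cI; pose J : {pred R} := ipow I k; have idJ : ideal_closed J := submodClosedP _.
apply: has_componentsI => x; apply: (span_ind (V := R^o) (Q := fun x : R^o =>
  exists p, [/\ graded_poly p, p.[1] = x & forall i, p`_i \in J])).
- by exists 0; split=> [i||i]; rewrite ?horner0 // coef0 ?rpred0 //; apply: ideal_closed0.
- move=> a u v [p [gp <- Jp]] [q [gq <- Jq]]; have [r gr_r <-] := graded_poly_ex a.
  exists (r * p + q); split.
  + exact/graded_polyD/gq/graded_polyM.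
  + by rewrite hornerD hornerM.
  + move=> i; rewrite coefD; apply: ideal_closedD => //; rewrite coefM.
    by apply: ideal_closed_sum => // j _; apply: ideal_closedM.
- move=> _ [[l sl] lI ->]; rewrite /J {J idJ} /=.
  have {lI} : {subset l <= I} := lI.
  move/eqP: sl => <-; elim: l => [|a l IH] lI.
    have [p gp p1] := graded_poly_ex 1; exists p; rewrite big_nil; split=> // i.
    by rewrite -[p`_i]mulr1; apply: (rpredZ (p`_i : R)); apply: ipow0_1.
  have [y yl|q [gq q1 Jq]] := IH; first by apply: lI; rewrite inE yl orbT.
  have [p gp pa] := graded_poly_ex a.
  exists (p * q); split; first exact: graded_polyM.
    by rewrite hornerM pa q1 big_cons.
  move=> i; rewrite coefM; apply: rpred_sum => j _; apply: ipowSM => //.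
  by apply: cI => //; rewrite pa; apply: lI; apply: mem_head.
Qed.

(* With [P = (J : x)] and [p] in [P], induction on [d] allows subtracting from
   [p] its components below [p_d]; then [p_d ^ (r + 1) x_r] is in [J] by induction
   on [r], so some power of [p_d] annihilates [x] modulo [J]. *)
Lemma Ass_has_components (J : submodClosed R^o) (P : prime_idealr R) :
  has_components J -> Ass (quotmod J) P -> has_components P.
Proof.
move=> cJ /Ass_quotmod[x xP]; have idJ : ideal_closed J := submodClosedP J.
have idP := prime_ideal_closed P.
have [q gq qx] := graded_poly_ex x.
move=> p gp Pp d; elim/ltn_ind: d => d IH.
pose low := \poly_(i < d) p`_i.
have Plow : low.[1] \in P.
  rewrite horner_poly; apply: ideal_closed_sum => // i _; rewrite mulrC.
  exact/ideal_closedM/IH.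
pose a := p - low.
have ga : graded_poly a.
  apply: graded_polyB => // i; rewrite coef_poly; case: ifP => // _; exact: rpred0.
have ad : a`_d = p`_d by rewrite coefB coef_poly ltnn subr0.
have alow i : (i < d)%N -> a`_i = 0 by move=> id; rewrite coefB coef_poly id subrr.
have Jaq i : (a * q)`_i \in J.
  apply: cJ; first exact: graded_polyM.
  by rewrite hornerM qx; apply/xP; rewrite hornerD hornerN; apply: ideal_closedB.
have key r : p`_d ^+ r.+1 * q`_r \in J.
  elim/ltn_ind: r => r IHr.
  have := Jaq (d + r)%N; rewrite coefM.
  have dr : (d < (d + r).+1)%N by rewrite ltnS leq_addr.
  rewrite (bigD1 (Ordinal dr)) //= addKn ad => Jdr.
  (* In degree [d + r] of [a * q], the terms with [i < d] vanish, and those with [i > d] involve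
     components of [x] of degree below [r], which the [r]-th power of [p_d] sends into [J] by
     induction. *)
  have -> : p`_d ^+ r.+1 * q`_r = p`_d ^+ r * (p`_d * q`_r +
      \sum_(i < (d + r).+1 | i != Ordinal dr) a`_i * q`_(d + r - i))
    - \sum_(i < (d + r).+1 | i != Ordinal dr) p`_d ^+ r * (a`_i * q`_(d + r - i)).
    by rewrite mulrDr mulr_sumr addrK exprSr mulrA.
  apply: ideal_closedB => //; first exact: ideal_closedM.
  apply: ideal_closed_sum => // i; rewrite -val_eqE /= => nid.
  have [id|di] := ltnP i d; first by rewrite alow // mul0r mulr0; apply: ideal_closed0.
  have {nid di} di : (d < i)%N by rewrite ltn_neqAle eq_sym nid.
  have ir : (d + r - i < r)%N.
    rewrite -[ltnRHS](addKn d r) ltn_sub2l // (leq_trans di) // -ltnS.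
    exact: ltn_ord.
  rewrite mulrCA; apply: (ideal_closedM idJ).
  exact: ideal_closed_expM ir (IHr _ ir).
(* The exponent [size q] exceeds the degree of every nonzero component of [x], so this power sends
   all of [x] into [J]. *)
have Pk : p`_d ^+ (size q) \in P.
  apply/xP; rewrite -qx horner_coef mulr_sumr; apply: ideal_closed_sum => // i _.
  rewrite expr1n mulr1; exact: ideal_closed_expM (ltn_ord i) (key i).
elim: (size q) Pk => [|k IHk]; first by rewrite expr0 idealr1.
by rewrite exprS prime_idealrM => /orP[].
Qed.

Lemma irrelevant_component x p : graded_poly p -> p.[1] = x ->
  x - p`_0 \in irrelevant gr.
Proof.
(* The sum runs up to [size p] inclusive, so that it has a degree 0 term to split off even when [p]
   is zero. *)
move=> gp <-; rewrite (horner_coef_wide _ (leqnSn (size p))) big_ord_recl expr0.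
rewrite mulr1 addrAC subrr add0r.
apply: (@rpred_sum R^o) => i _; rewrite expr1n mulr1; apply: span_incl.
by exists (bump 0 i).
Qed.

End Graded.

(** * Stability of associated primes and depth *)

Lemma enat_min_le (A : set nat) n : A n -> enat_le (enat_min A) (Some n).
Proof.
move=> An; rewrite /enat_min; case: pselect => [exA|]; last first.
  by case; exists n; apply/asboolP.
by case: ex_minnP => k _; apply; apply/asboolP.
Qed.

Section Stability.
Variables (R : comNzRingType) (m : prime_idealr R) (I : idealr R).
Variable S : prime_idealr R -> Prop.
Hypotheses (noeR : noetherian R) (idI : ideal_closed I) (Im : {subset I <= m}).
(** Maximality of [m], in the form that turns an inclusion of [m] in a proper [(J : x)] into an
    equality. *)
Hypothesis mmax : forall (J : submodClosed R^o) (x a : R),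
  (forall b, b \in m -> b * x \in J) -> x \notin J -> a * x \in J -> a \in m.
(** Depth functions are assumed non-increasing only at primes of [S], which in the graded case are
    the graded primes. *)
Hypothesis AssS : forall P k, (0 < k)%N -> Ass_pow I k P -> S P.

Lemma Ass_pow_Vprimes P k : Ass_pow I k P -> Vprimes I P.
Proof.
move=> /Ass_subset kP a Ia; have := kP _ (ipow_exp k Ia).
elim: k {kP} => [|k IH]; first by rewrite expr0 idealr1.
by rewrite exprS prime_idealrM => /orP[].
Qed.

(** Here the depth is taken over [R] itself; [mmax] ensures that an element annihilated by [m]
    modulo the power has annihilator exactly [m]. *)
Lemma depth_ipow_eq0 k : (0 < k)%N ->
  depth m (quotmod (ipow I k)) = Some 0%N <-> Ass_pow I k m.
Proof.
move=> k0; have idm := prime_ideal_closed m.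
have km := ipow_sub idm Im k0.
rewrite (depth_eq0 idm _ km) ?idealr1 // /Ass_pow Ass_quotmod; split=> [zd|[x xm] a ma].
  have [|x xk mx] := annihilated_by_zero_divisors noeR idm (submodClosedP (ipow I k)).
    exact: zd.
  by exists x => a; split=> [/mx //|]; apply: mmax.
exists x; last exact/xm.
by apply/negP => xk; have /negP[] := negbT (idealr1 m); apply/xm; rewrite mul1r.
Qed.

Lemma depth_function_eq0 P k : Vprimes I P -> (0 < k)%N ->
  depth_function I P k = Some 0%N <-> Ass_pow I k P.
Proof.
by move=> IP k0; apply: depth_loc_eq0 => //; apply: ipow_sub => //; apply: prime_ideal_closed.
Qed.

Lemma depth_loc_ipow_eq0 P k : Vprimes I P -> (0 < k)%N ->
  depth (@loc_max R P) (quotmod (ipow (loc_ext P I) k)) = Some 0%N <-> Ass_pow I k P.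
Proof.
move=> IP k0; apply: depth_loc_eq0 => //; last exact: ipow_sub (prime_ideal_closed P) IP k0.
by move=> z; apply/esym/loc_ext_ipow.
Qed.

Lemma nonincreasing_depth_persistent :
  nonincreasing_ge1 (fun k => depth m (quotmod (ipow I k))) -> persistent I m.
Proof.
move=> ni; split=> // k k1 /(depth_ipow_eq0 k1) d0; apply/depth_ipow_eq0 => //.
by apply: enat_le0; rewrite -d0; apply: ni; rewrite k1 leqnSn.
Qed.

Lemma nonincreasing_persistence :
  nonincreasing_depth_functions I S -> persistence_property I.
Proof.
move=> ni P k k1 kP; have IP := Ass_pow_Vprimes kP; split=> // l l1 lP.
apply/(depth_function_eq0 IP) => //; apply: enat_le0.
rewrite -((depth_function_eq0 IP l1).2 lP); apply: ni; rewrite ?l1 ?leqnSn //.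
exact: AssS kP.
Qed.

(** At a prime of [Ass_infty I] the depth is 0 from [astab I] on, hence constant there, which bounds
    [dstab_loc]. *)
Lemma sup_dstab_le_astab :
  enat_le (sup_dstab_loc I (Ass_infty I)) (astab I).
Proof.
case E: (astab I) => [n|]; last by case: sup_dstab_loc.
have [[n1 nst] nmin] := (enat_minP _ _).1 E.
apply: enat_sup_least => _ [P [k1 k1st k1P] ->]; apply: enat_min_le.
have nP : Ass_pow I n P by apply/(nst k1 (nmin _ k1st)).
have IP := Ass_pow_Vprimes nP; split=> // k nk.
have k0 : (0 < k)%N := leq_trans n1 nk.
rewrite ((depth_loc_ipow_eq0 IP k0).2 _); last exact/(nst k nk).
by rewrite ((depth_loc_ipow_eq0 IP n1).2 nP).
Qed.

(** From a finite supremum [n] on, all local depths are constant, and their vanishing decides which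
    primes are associated. *)
Lemma astab_le_sup_dstab : enat_le (astab I) (sup_dstab_loc I (Vprimes I)).
Proof.
case E: (sup_dstab_loc I (Vprimes I)) => [n|]; last by case: astab.
have dst P : Vprimes I P -> exists2 k0, (k0 <= n)%N & dstab_loc I P = Some k0.
  move=> IP; have : enat_le (dstab_loc I P) (sup_dstab_loc I (Vprimes I)).
    by apply: enat_sup_ub; exists P.
  by rewrite E; case: dstab_loc => // k0 k0n; exists k0.
(* [V(I)] contains [m], and [dstab_loc] is at least 1 there. *)
have n1 : (0 < n)%N.
  have [k0 k0n /enat_minP[[k01 _] _]] := dst m Im; exact: leq_trans k0n.
apply: enat_min_le; split=> // k nk P.
have k1 := leq_trans n1 nk.
have stP : Vprimes I P -> Ass_pow I k P <-> Ass_pow I n P.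
  move=> IP; have [k0 k0n /enat_minP[[_ st] _]] := dst P IP.
  rewrite -(depth_loc_ipow_eq0 IP k1) -(depth_loc_ipow_eq0 IP n1).
  by rewrite (st k (leq_trans k0n nk)) (st n k0n).
by split=> aP; apply/stP => //; apply: Ass_pow_Vprimes aP.
Qed.

End Stability.

Lemma idealr_ideal_closed (R : comNzRingType) (I : idealr R) : ideal_closed I.
Proof.
split=> [|a u v Iu Iv]; first exact: rpred0.
by rewrite rpredD //; apply: idealMr.
Qed.

(** * The maximal ideal of a noetherian local ring *)

Section Local.
Variables (R : comNzRingType) (m : prime_idealr R).
Hypotheses (noeR : noetherian R) (locR : local_ring m).

Lemma idealr_of_closed (p : {pred R}) : ideal_closed p -> 1 \notin p ->
  exists J : idealr R, J =i p.
Proof.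
move=> [p0 pZD] p1; have h : idealr_closed p.
  by split=> // a u v; apply: pZD.
by exists (HB.pack_for (idealr R) p (isIdealr.Build R p h)).
Qed.

(** The noetherian condition, in place of Zorn's lemma, enlarges [p] to a maximal ideal, which can
    only be [m]. *)
Lemma proper_sub_local (p : {pred R}) : ideal_closed p -> 1 \notin p -> {subset p <= m}.
Proof.
move=> idp p1; case: locR => _ muniq.
pose F (q : {pred R}) := [/\ ideal_closed q, 1 \notin q & {subset p <= q}].
have [q [] //||q [idq q1 pq] qmax] := @noetherian_max R F noeR.
  by exists p; split.
have [n nq] := idealr_of_closed idq q1.
have nmax : maximal_ideal n.
  move=> J nJ x; apply/idP/idP => [Jx|/nJ //]; rewrite nq.
  apply: (qmax J) => //; last by move=> y; rewrite -nq; apply: nJ.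
  split; last by move=> y /pq; rewrite -nq => /nJ.
    exact: idealr_ideal_closed.
  by rewrite idealr1.
by move=> x /pq; rewrite -nq muniq.
Qed.

End Local.

(** * The graded maximal ideal of a standard graded algebra *)

Section GradedMaximal.
Variables (K : fieldType) (R : comAlgType K) (gr : nat -> submodClosed R).
Variables (m : prime_idealr R).
Hypotheses (std : standard_graded gr) (mE : m =i irrelevant gr).

Lemma scalar_component p : graded_poly gr p -> exists c : K, p`_0 = c%:A.
Proof. by move=> /(_ 0%N) p0; case: std => _ _ _ /(_ p`_0)[+ _] _; apply. Qed.

Lemma component_irrelevant p : graded_poly gr p -> p.[1] - p`_0 \in m.
Proof. by move=> gp; rewrite mE; apply: irrelevant_component. Qed.

(** If the degree 0 component [c] of [a] is nonzero, then [x] is [c^-1] times [a x - (a - c) x],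
    which is in [J] because [a - c] is in [m]. *)
Lemma irrelevant_maximal (J : submodClosed R^o) (x a : R) :
  (forall b, b \in m -> b * x \in J) -> x \notin J -> a * x \in J -> a \in m.
Proof.
move=> mJ xJ; have [p gp <-] := graded_poly_ex std a => aJ.
have pm := component_irrelevant gp; have [c pc] := scalar_component gp.
have [c0|c0] := eqVneq c 0; first by rewrite pc c0 scale0r subr0 in pm.
have idJ : ideal_closed J := submodClosedP J.
case/negP: xJ; have -> : x = (c^-1)%:A * (p.[1] * x - (p.[1] - p`_0) * x).
  by rewrite mulrBl opprB addrC subrK pc !mulr_algl scalerA mulVf // scale1r.
by apply/(ideal_closedM idJ)/(ideal_closedB idJ) => //; apply: mJ.
Qed.

(** The degree 0 component of an element of [I] is a scalar in [I]; if nonzero, it would be a unit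
    in a proper ideal. *)
Lemma graded_sub_irrelevant (I : idealr R) : graded_ideal gr I -> {subset I <= m}.
Proof.
move=> gI x; have [p gp <-] := graded_poly_ex std x => Ip.
have pm := component_irrelevant gp; have [c pc] := scalar_component gp.
have [c0|c0] := eqVneq c 0; first by rewrite pc c0 scale0r subr0 in pm.
have := graded_has_components std (idealr_ideal_closed I) gI gp Ip 0%N.
rewrite pc => /(ideal_closedM (idealr_ideal_closed I) (c^-1)%:A).
by rewrite mulr_algl scalerA mulVf // scale1r idealr1.
Qed.

End GradedMaximal.

Theorem proposition1p1 :
  (* Noetherian local rings. *)
  (forall (R : comNzRingType) (m : prime_idealr R) (I : idealr R),
     noetherian R -> local_ring m ->
     [/\ (nonincreasing_ge1 (fun k => depth m (quotmod (ipow I k))) ->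
            persistent I m),
         (nonincreasing_depth_functions I (fun _ => True) ->
            persistence_property I),
         enat_le (sup_dstab_loc I (Ass_infty I)) (astab I)
       & (nonincreasing_depth_functions I (fun _ => True) ->
            enat_le (astab I) (sup_dstab_loc I (Vprimes I)))])
  /\
  (* Standard graded algebras over a field. *)
  (forall (K : fieldType) (R : comAlgType K) (gr : nat -> submodClosed R)
          (m : prime_idealr R) (I : idealr R),
     standard_graded gr -> m =i irrelevant gr -> graded_ideal gr I ->
     [/\ (nonincreasing_ge1 (fun k => depth m (quotmod (ipow I k))) ->
            persistent I m),
         (nonincreasing_depth_functions I (fun P => graded_ideal gr P) ->
            persistence_property I),
         enat_le (sup_dstab_loc I (Ass_infty I)) (astab I)
       & (nonincreasing_depth_functions I (fun P => graded_ideal gr P) ->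
            enat_le (astab I) (sup_dstab_loc I (Vprimes I)))]).
Proof.
split=> [R m I noeR locR|K R gr m I std mE gI]; have idI := idealr_ideal_closed I.
  have Im : {subset I <= m} by apply: proper_sub_local; rewrite ?idealr1.
  have mmax (J : submodClosed R^o) (x a : R) :
      (forall b, b \in m -> b * x \in J) -> x \notin J -> a * x \in J -> a \in m.
    (* In a local ring [(J : x)], being a proper ideal, lies in [m]. *)
    move=> _ xJ; apply: (proper_sub_local noeR locR (p := colon J x)).
      exact/colon_ideal/submodClosedP.
    by rewrite inE mul1r.
  split; [exact: nonincreasing_depth_persistent | exact: nonincreasing_persistence
    | exact: sup_dstab_le_astab | by move=> _; apply: (astab_le_sup_dstab noeR idI Im)].
have noeR : noetherian R.
  by case: std => _ _ _ _ [s _]; apply: noetherian_fg_algebra.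
have Im := graded_sub_irrelevant std mE gI.
have mmax := irrelevant_maximal std mE.
split; [exact: nonincreasing_depth_persistent | | exact: sup_dstab_le_astab
  | by move=> _; apply: (astab_le_sup_dstab noeR idI Im)].
(* The remaining condition [AssS] holds because powers of [I] are graded, and so are their
   associated primes. *)
apply: nonincreasing_persistence => // P k k1 kP.
apply: (has_components_graded std (prime_ideal_closed P)).
apply: (Ass_has_components std _ kP); apply: (ipow_has_components std).
exact: graded_has_components.
Qed.
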